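(* Let $B$ be a Banach $f$-algebra, and let $A\subseteq B$ be a closed sublattice-algebra. Then for every lattice-algebra homomorphism $\phi\colon A\to\mathbb{R}$ there exists a lattice-algebra homomorphism $\psi\colon B\to\mathbb{R}$ such that $\psi|_A=\phi$.
   Context: All spaces are real. A vector lattice algebra is a real associative algebra that is also a vector lattice in which the product of positive elements is positive. An $f$-algebra is a vector lattice algebra such that $a\wedge b=0$ and $c\ge 0$ imply $(ac)\wedge b=0=(ca)\wedge b$. A Banach $f$-algebra is an $f$-algebra equipped with a complete, submultiplicative lattice norm (lattice norm: $|x|\le |y|$ implies $\|x\|\le\|y\|$). A sublattice-algebra is a linear subspace closed under the lattice operations and the product. A lattice-algebra homomorphism is a linear map preserving the lattice operations and the product (it may be zero). $\mathbb{R}$ carries its usual order and product. *)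

(* Defs.v *)
From HB Require Import structures.
From mathcomp Require Import all_boot all_order all_algebra.
From mathcomp Require Import all_classical all_reals all_analysis.

Set Implicit Arguments.
Unset Strict Implicit.
Unset Printing Implicit Defensive.

Import Order.TTheory GRing.Theory Num.Theory numFieldNormedType.Exports.
Local Open Scope classical_set_scope.
Local Open Scope ring_scope.

(* The order and the lattice operations are fields of their own: a join of
   [Order.Lattice] with [GRing.Lmodule] or [NormedModule] is rejected by HB,
   because [Num.RealDomain] already inherits from both sides. *)
HB.mixin Record Lmodule_isVectorLattice (R : realType) V
    of GRing.Lmodule R V := {
  vle : rel V;
  vjoin : V -> V -> V;
  vmeet : V -> V -> V;
  vle_refl : reflexive vle;
  vle_anti : antisymmetric vle;
  vle_trans : transitive vle;
  vle_joinl : forall x y z : V, vle (vjoin x y) z = vle x z && vle y z;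
  vle_meetr : forall x y z : V, vle z (vmeet x y) = vle z x && vle z y;
  vle_add2r : forall z x y : V, vle x y -> vle (x + z) (y + z);
  vscale_ge0 : forall (a : R) (x : V), 0 <= a -> vle 0 x -> vle 0 (a *: x)
}.

#[short(type="vectorLatticeType")]
HB.structure Definition VectorLattice (R : realType) :=
  { V of GRing.Lmodule R V & Lmodule_isVectorLattice R V }.

(* Algebras need not be unital, which rules out [lalgType]/[algType]. *)
HB.mixin Record VectorLattice_isVectorLatticeAlgebra (R : realType) V
    of VectorLattice R V := {
  vmul : V -> V -> V;
  vmulA : associative vmul;
  vmulDl : left_distributive vmul +%R;
  vmulDr : right_distributive vmul +%R;
  vmulZl : forall (a : R) (x y : V), vmul (a *: x) y = a *: vmul x y;
  vmulZr : forall (a : R) (x y : V), vmul x (a *: y) = a *: vmul x y;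
  vmul_ge0 : forall x y : V, vle 0 x -> vle 0 y -> vle 0 (vmul x y)
}.

#[short(type="vectorLatticeAlgType")]
HB.structure Definition VectorLatticeAlgebra (R : realType) :=
  { V of VectorLattice R V & VectorLattice_isVectorLatticeAlgebra R V }.

Notation "x ** y" := (vmul x y) (at level 40, left associativity) : ring_scope.

HB.mixin Record VectorLatticeAlgebra_isFAlgebra (R : realType) V
    of VectorLatticeAlgebra R V := {
  falg_disjoint : forall a b c : V, vmeet a b = 0 -> vle 0 c ->
    vmeet (a ** c) b = 0 /\ vmeet (c ** a) b = 0
}.

#[short(type="fAlgebraType")]
HB.structure Definition FAlgebra (R : realType) :=
  { V of VectorLatticeAlgebra R V & VectorLatticeAlgebra_isFAlgebra R V }.

(* The lattice modulus of x; the notation [`|x|] is the norm. *)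
Definition vabs (R : realType) (V : vectorLatticeType R) (x : V) : V :=
  vjoin x (- x).

HB.mixin Record FAlgebra_isBanachFAlgebra (R : realType) V
    of FAlgebra R V & CompleteNormedModule R V := {
  lattice_norm : forall x y : V, vle (vabs x) (vabs y) -> `|x| <= `|y|;
  normvM_le : forall x y : V, `|x ** y| <= `|x| * `|y|
}.

#[short(type="banachFAlgebraType")]
HB.structure Definition BanachFAlgebra (R : realType) :=
  { V of FAlgebra R V & CompleteNormedModule R V
       & FAlgebra_isBanachFAlgebra R V }.

Record sublattice_algebra (R : realType) (V : vectorLatticeAlgType R)
    (A : set V) : Prop := {
  sla0 : A 0;
  slaD : forall x y, A x -> A y -> A (x + y);
  slaZ : forall (a : R) x, A x -> A (a *: x);
  sla_join : forall x y, A x -> A y -> A (vjoin x y);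
  sla_meet : forall x y, A x -> A y -> A (vmeet x y);
  slaM : forall x y, A x -> A y -> A (x ** y)
}.

(* A map on the sublattice-algebra A is represented by a total function of
   which only the values on A matter. *)
Record lattice_algebra_hom_on (R : realType) (V : vectorLatticeAlgType R)
    (A : set V) (f : V -> R) : Prop := {
  lahD : forall x y, A x -> A y -> f (x + y) = f x + f y;
  lahZ : forall (a : R) x, A x -> f (a *: x) = a * f x;
  lah_join : forall x y, A x -> A y ->
    f (vjoin x y) = Num.max (f x) (f y);
  lah_meet : forall x y, A x -> A y ->
    f (vmeet x y) = Num.min (f x) (f y);
  lahM : forall x y, A x -> A y -> f (x ** y) = f x * f y
}.

(* Main.v *)
Require Import Defs.
From mathcomp Require Import all_boot all_order all_algebra.
From mathcomp Require Import all_classical all_reals all_analysis.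

Set Implicit Arguments.
Unset Strict Implicit.
Unset Printing Implicit Defensive.

Import Order.TTheory GRing.Theory Num.Theory numFieldNormedType.Exports.
Local Open Scope classical_set_scope.
Local Open Scope ring_scope.

(** Suppose [phi] is not zero and take a positive [e] in [A] with
    [phi e = 1]. An extension [psi] must satisfy [psi x = psi (x ** e)], and
    [x ** e] lies in the order ideal of [B] generated by [e]: multiplication by
    [x] is dominated by a multiple of the identity ([vmul_bounded]). So it
    suffices to find a real-valued quotient of that ideal which kills the
    kernel of [phi].

    That quotient comes from Zorn's lemma. The order ideal of [B] generated by
    the kernel of [phi] does not contain [e], since [e <= j] would give
    [1 <= phi j]; let [N] be maximal among the order ideals that contain it and
    avoid [e]. Such an [N] is prime ([maximal_prime]), and modulo [N] every
    element of the ideal generated by [e] is a unique real multiple of [e]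
    ([maximal_quotient]). Define [psi x] by [x ** e = psi x *: e] modulo [N].
    Then [psi] is a lattice homomorphism because [N] is prime. It is
    multiplicative because
      [x ** y ** e - (psi x * psi y) *: e
         = x ** (y ** e - psi y *: e) + psi y *: (x ** e - psi x *: e)]
    and, again by [vmul_bounded], [N] is invariant under multiplication by
    [x]. It extends [phi] because [x ** e - phi x *: e] is in the kernel of
    [phi] when [x] is in [A].

    The analytic input is the bound on multiplication, which says that
    [x ** e <= e] if [x] and [e] are positive and [x] has norm at most one half.
    A partial sum [g] of the Neumann series of [x] at [e] satisfies [e <= g]
    and [x ** g <= g + h] with [h] of small norm. The disjointness axiom makes
    multiplication by [x] local, so it acts like a function that is at most
    about [1] wherever [g] is positive; [vmul_le_slices] turns this into
    the inequality [x ** e <= e + n.+1^-1 *: g + h], and the norm removes the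
    last two terms. *)

(** * Vector lattices *)

Definition vpos (R : realType) (V : vectorLatticeType R) (x : V) : V :=
  vjoin x 0.

Section VectorLattice.
Context {R : realType} {V : vectorLatticeType R}.
Implicit Types (x y z w : V) (a b : R).

Lemma le_vle_trans y x z : vle x y -> vle y z -> vle x z.
Proof. exact: vle_trans. Qed.

Lemma vle_D2r z x y : vle (x + z) (y + z) = vle x y.
Proof.
apply/idP/idP => [|/vle_add2r//].
by move=> /(vle_add2r (- z)); rewrite !addrK.
Qed.

Lemma vle_D2l z x y : vle (z + x) (z + y) = vle x y.
Proof. by rewrite ![z + _]addrC vle_D2r. Qed.

Lemma vsub_ge0 x y : vle 0 (y - x) = vle x y.
Proof. by rewrite -(vle_D2r x) add0r subrK. Qed.

Lemma vle_subl x y z : vle (x - y) z = vle x (z + y).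
Proof. by rewrite -(vle_D2r y) subrK. Qed.

Lemma vle_subr x y z : vle x (y - z) = vle (x + z) y.
Proof. by rewrite -(vle_D2r z) subrK. Qed.

Lemma vle_opp2 x y : vle (- x) (- y) = vle y x.
Proof. by rewrite -vsub_ge0 opprK addrC vsub_ge0. Qed.

Lemma vleD x y z w : vle x y -> vle z w -> vle (x + z) (y + w).
Proof.
by move=> xy zw; apply: (@le_vle_trans (y + z)); rewrite ?vle_D2r ?vle_D2l.
Qed.

Lemma vaddr_ge0 x y : vle 0 x -> vle 0 y -> vle 0 (x + y).
Proof. by move=> x0 y0; rewrite -[0]addr0; exact: vleD. Qed.

Lemma vle_addr x y : vle 0 y -> vle x (x + y).
Proof. by move=> y0; rewrite -{1}[x]addr0 vle_D2l. Qed.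

Lemma vle_addl x y : vle 0 y -> vle x (y + x).
Proof. by move=> y0; rewrite addrC; exact: vle_addr. Qed.

Lemma vleZ a x y : 0 <= a -> vle x y -> vle (a *: x) (a *: y).
Proof.
by move=> a0 xy; rewrite -vsub_ge0 -scalerBr vscale_ge0// vsub_ge0.
Qed.

Lemma vleZr a b x : a <= b -> vle 0 x -> vle (a *: x) (b *: x).
Proof.
by move=> ab x0; rewrite -vsub_ge0 -scalerBl vscale_ge0// subr_ge0.
Qed.

Lemma vleZ2 a x y : 0 < a -> vle (a *: x) (a *: y) = vle x y.
Proof.
move=> a0; apply/idP/idP => [|/(vleZ (ltW a0))//].
move=> /(@vleZ a^-1); rewrite invr_ge0 !scalerK ?gt_eqF//.
by apply; exact: ltW.
Qed.

Lemma vle_joinL x y : vle x (vjoin x y).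
Proof. by have := vle_refl (vjoin x y); rewrite vle_joinl => /andP[]. Qed.

Lemma vle_joinR x y : vle y (vjoin x y).
Proof. by have := vle_refl (vjoin x y); rewrite vle_joinl => /andP[]. Qed.

Lemma vle_meetL x y : vle (vmeet x y) x.
Proof. by have := vle_refl (vmeet x y); rewrite vle_meetr => /andP[]. Qed.

Lemma vle_meetR x y : vle (vmeet x y) y.
Proof. by have := vle_refl (vmeet x y); rewrite vle_meetr => /andP[]. Qed.

(** An element is determined by its upper bounds, so the identities between
    joins below reduce to the universal property [vle_joinl]. *)
Lemma eq_vle x y : (forall z, vle x z = vle y z) -> x = y.
Proof.
by move=> xy; apply: vle_anti; rewrite xy vle_refl -xy vle_refl.
Qed.

Lemma vjoinC x y : vjoin x y = vjoin y x.
Proof. by apply: eq_vle => z; rewrite !vle_joinl andbC. Qed.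

Lemma vjoinDr x y z : vjoin (x + z) (y + z) = vjoin x y + z.
Proof.
by apply: eq_vle => w; rewrite vle_joinl -!vle_subr vle_joinl.
Qed.

Lemma vjoinN x y : vjoin (- x) (- y) = - vmeet x y.
Proof.
apply: eq_vle => w; rewrite -[w]opprK vle_joinl !vle_opp2.
by rewrite vle_meetr.
Qed.

Lemma vmeetC x y : vmeet x y = vmeet y x.
Proof. by apply: oppr_inj; rewrite -!vjoinN vjoinC. Qed.

Lemma vjoinE x y : vjoin x y = vpos (x - y) + y.
Proof. by rewrite /vpos -vjoinDr subrK add0r. Qed.

Lemma vmeetE x y : vmeet x y = x + y - vjoin x y.
Proof.
apply: oppr_inj; rewrite -vjoinN opprB -vjoinDr vjoinC.
by congr vjoin; rewrite opprD addrC ?subrK// addrAC addNr add0r.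
Qed.

Lemma vmeet_ge0 x y : vle 0 x -> vle 0 y -> vle 0 (vmeet x y).
Proof. by rewrite vle_meetr => -> ->. Qed.

Lemma vpos_ge0 x : vle 0 (vpos x).
Proof. exact: vle_joinR. Qed.

Lemma vle_vpos x : vle x (vpos x).
Proof. exact: vle_joinL. Qed.

Lemma vpos_le x y : vle (vpos x) y = vle x y && vle 0 y.
Proof. exact: vle_joinl. Qed.

Lemma vpos_le0 x : vle x 0 -> vpos x = 0.
Proof.
move=> x0; apply: vle_anti.
by rewrite vpos_le x0 vle_refl vpos_ge0.
Qed.

Lemma vpos_id x : vle 0 x -> vpos x = x.
Proof.
by move=> x0; apply: vle_anti; rewrite vpos_le vle_refl x0 vle_vpos.
Qed.

Lemma le_vpos x y : vle x y -> vle (vpos x) (vpos y).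
Proof.
by move=> xy; rewrite vpos_le vpos_ge0 (le_vle_trans xy) ?vle_vpos.
Qed.

Lemma vposBN x : vpos x - vpos (- x) = x.
Proof.
rewrite /vpos -{2}[0](subrr x) -[X in vjoin X (x - x)]add0r.
by rewrite vjoinDr vjoinC opprB addrC subrK.
Qed.

Lemma vpos_disjoint x : vmeet (vpos x) (vpos (- x)) = 0.
Proof.
by rewrite vmeetE vjoinE vposBN subrr.
Qed.

(** Domination on a band: wherever [z] is positive [y] vanishes, so there the
    bound [x + y] is just [x]. *)
Lemma disjoint_le x y z :
  vle 0 x -> vmeet z y = 0 -> vle z (x + y) -> vle z x.
Proof.
move=> x0 zy zxy.
have : vle (z - x) (vmeet z y).
  by rewrite vle_meetr !vle_subl vle_addr //= addrC.
by rewrite zy vle_subl add0r.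
Qed.

Lemma disjointS x y z :
  vle 0 x -> vle x y -> vle 0 z -> vmeet y z = 0 -> vmeet x z = 0.
Proof.
move=> x0 xy z0 yz; apply: vle_anti; rewrite vmeet_ge0// andbT -yz.
by rewrite vle_meetr vle_meetR (le_vle_trans (vle_meetL _ _) xy).
Qed.

Lemma vabs_le x y : vle (vabs x) y = vle x y && vle (- x) y.
Proof. exact: vle_joinl. Qed.

Lemma vle_abs x : vle x (vabs x).
Proof. exact: vle_joinL. Qed.

Lemma vleN_abs x : vle (- x) (vabs x).
Proof. exact: vle_joinR. Qed.

Lemma vabs_ge0 x : vle 0 (vabs x).
Proof.
rewrite -(vleZ2 _ _ (ltr0n R 2)) scaler0 scaler_nat mulr2n.
by rewrite -(subrr x) vleD ?vle_abs ?vleN_abs.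
Qed.

Lemma vabs_id x : vle 0 x -> vabs x = x.
Proof.
move=> x0; apply: vle_anti; rewrite vle_abs vabs_le vle_refl /= andbT.
by apply: (@le_vle_trans 0); rewrite // -oppr0 vle_opp2.
Qed.

Lemma vabsD x y : vle (vabs (x + y)) (vabs x + vabs y).
Proof. by rewrite vabs_le opprD !vleD ?vle_abs ?vleN_abs. Qed.

Lemma vabsZ a x : vle (vabs (a *: x)) (`|a| *: vabs x).
Proof.
rewrite vabs_le; have [a0|a0] := leP 0 a.
  by rewrite ger0_norm// -scalerN !vleZ ?vle_abs ?vleN_abs.
have Na0 : 0 <= - a by rewrite oppr_ge0 ltW.
have ax : a *: x = (- a) *: (- x) by rewrite scaleNr scalerN opprK.
rewrite ltr0_norm// -scaleNr ax.
by rewrite !vleZ ?vle_abs ?vleN_abs.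
Qed.

End VectorLattice.

(** * Multiplication is bounded by a scalar *)

Section VectorLatticeAlgebra.
Context {R : realType} {V : vectorLatticeAlgType R}.
Implicit Types (x y z : V) (a : R).

Lemma vmulNr x y : x ** (- y) = - (x ** y).
Proof. by rewrite -scaleN1r vmulZr scaleN1r. Qed.

Lemma vmulNl x y : (- x) ** y = - (x ** y).
Proof. by rewrite -scaleN1r vmulZl scaleN1r. Qed.

Lemma le_vmull x y z : vle 0 x -> vle y z -> vle (x ** y) (x ** z).
Proof.
by move=> x0 yz; rewrite -vsub_ge0 -vmulNr -vmulDr vmul_ge0// vsub_ge0.
Qed.

End VectorLatticeAlgebra.

Lemma vmul_disjoint (R : realType) (V : fAlgebraType R) (x y z : V) :
  vle 0 x -> vmeet z y = 0 -> vmeet z (x ** y) = 0.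
Proof.
rewrite vmeetC => x0 yz; rewrite vmeetC.
by have [] := falg_disjoint _ _ _ yz x0.
Qed.

Lemma le_of_le_harmonic (R : realType) (a b c : R) :
  (forall n, a <= n.+1%:R^-1 * b + c) -> a <= c.
Proof.
move=> abc; apply/ler_addgt0Pr => eps eps0.
have [b0|b0] := leP b 0.
  apply: (le_trans (abc 0%N)); rewrite addrC lerD2l invr1 mul1r.
  by rewrite (le_trans b0)// ltW.
have bound_gt := @archi_boundP R _ (ltW (divr_gt0 b0 eps0)).
apply: (le_trans (abc (Num.bound (b / eps)))).
rewrite addrC lerD2l mulrC ler_pdivrMr ?ltr0n// mulrC -ler_pdivrMr//.
by rewrite (le_trans (ltW bound_gt))// ler_nat.
Qed.

(** A slicing argument. Think of [x] as multiplication by a function and let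
    [z] be the positive part of [x ** e - e - n.+1^-1 *: g - h]. Where [z] is
    positive and [e] is at most [t *: g], one has
    [x ** e <= t *: (x ** g) <= t *: g + h], so in fact
    [e <= (t - n.+1^-1) *: g] there. Starting from [e <= g], that is [t = 1],
    after [n.+1] steps this leaves [e = 0] wherever [z] is positive, which
    forces [z = 0] since [z <= x ** e]. The localisation to the set where [z]
    is positive is expressed by disjointness. *)
Lemma vmul_le_slices (R : realType) (V : fAlgebraType R) (x e g h : V) n :
  vle 0 x -> vle 0 e -> vle 0 h -> vle e g -> vle (x ** g) (g + h) ->
  vle (x ** e) (e + n.+1%:R^-1 *: g + h).
Proof.
move=> x0 e0 h0 eg xg; set d := n.+1%:R^-1 : R.
have d0 : 0 <= d by rewrite invr_ge0.
have g0 : vle 0 g := le_vle_trans e0 eg.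
have xe0 : vle 0 (x ** e) := vmul_ge0 _ _ x0 e0.
pose z := vpos (x ** e - (e + d *: g + h)).
have z0 : vle 0 z := vpos_ge0 _.
have zxe : vle z (x ** e).
  by rewrite vpos_le xe0 andbT vle_subl vle_addr// !vaddr_ge0 ?vscale_ge0.
have disj k : (k <= n.+1)%N -> vmeet z (vpos (e - (1 - k%:R * d) *: g)) = 0.
  elim: k => [_|k IHk kn].
    rewrite mul0r subr0 scale1r vpos_le0 ?vle_subl ?add0r//.
    by apply: vle_anti; rewrite vle_meetR vmeet_ge0 ?vle_refl.
  have {IHk} := IHk (ltnW kn).
  set t := 1 - k%:R * d => zt.
  have t0 : 0 <= t.
    by rewrite subr_ge0 ler_pdivrMr ?ltr0n// mul1r ler_nat ltnW.
  have t1 : t <= 1 by rewrite gerBl mulr_ge0.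
  have -> : 1 - k.+1%:R * d = t - d.
    by rewrite -natr1 mulrDl mul1r opprD addrA.
  have zle : vle z (vpos ((t - d) *: g - e)).
    apply: (disjoint_le (vpos_ge0 _) (vmul_disjoint x0 zt)).
    rewrite vpos_le vaddr_ge0 ?vpos_ge0 ?vmul_ge0 ?vpos_ge0// andbT.
    rewrite vle_subl.
    apply: (@le_vle_trans _ _ (((t - d) *: g - e +
        x ** vpos (e - t *: g)) + (e + d *: g + h))); last first.
      by rewrite vle_D2r vle_D2r vle_vpos.
    have -> : ((t - d) *: g - e + x ** vpos (e - t *: g)) + (e + d *: g + h)
        = t *: g + h + x ** vpos (e - t *: g).
      by rewrite addrAC scalerBl -[_ - e]addrA -opprD [e + _]addrC addrA subrK.
    apply: (@le_vle_trans _ _ (x ** (t *: g + vpos (e - t *: g)))).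
      by apply: le_vmull => //; rewrite addrC -vle_subl vle_vpos.
    rewrite vmulDr vle_D2r vmulZr.
    apply: (le_vle_trans (vleZ t0 xg)); rewrite scalerDr vle_D2l.
    by rewrite -[X in vle _ X]scale1r vleZr.
  apply: (disjointS z0 zle (vpos_ge0 _)).
  by rewrite -[e - _]opprB vpos_disjoint.
have ze : vmeet z e = 0.
  have := disj n.+1 (leqnn _).
  by rewrite divff// subrr scale0r subr0 (vpos_id e0).
have : vle z (vmeet z (x ** e)) by rewrite vle_meetr vle_refl.
by rewrite (vmul_disjoint x0 ze) vpos_le vle_subl add0r => /andP[].
Qed.

(** A partial sum [g] of the Neumann series of [x] applied to [e] satisfies
    [x ** g <= g + h], where the error [h] is the last iterate of [e]. *)
Lemma neumann_partial_sum (R : realType) (B : banachFAlgebraType R)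
    (x e : B) m :
  vle 0 x -> vle 0 e -> `|x| <= 2^-1 ->
  exists g h : B, [/\ vle 0 h, vle e g, vle (x ** g) (g + h) &
    `|h| <= 2^-1 ^+ m * `|e|].
Proof.
move=> x0 e0 xhalf; elim: m => [|m [g [h [h0 eg xg hm]]]].
  exists e, (x ** e); split; rewrite ?vle_refl ?vmul_ge0 ?vle_addl//.
  rewrite expr0 (le_trans (normvM_le _ _))// ler_wpM2r//.
  by rewrite (le_trans xhalf)// invf_le1// ler1n.
exists (g + h), (x ** h); split.
- exact: vmul_ge0.
- exact: le_vle_trans eg (vle_addr _ h0).
- by rewrite vmulDr vle_D2r.
- by rewrite (le_trans (normvM_le _ _))// exprS -mulrA ler_pM.
Qed.

Lemma ler_norm_pos (R : realType) (B : banachFAlgebraType R) (x y : B) :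
  vle 0 x -> vle x y -> `|x| <= `|y|.
Proof.
move=> x0 xy; apply: lattice_norm.
by rewrite !vabs_id// (le_vle_trans x0).
Qed.

Lemma vmul_le_small (R : realType) (B : banachFAlgebraType R) (x e : B) :
  vle 0 x -> vle 0 e -> `|x| <= 2^-1 -> vle (x ** e) e.
Proof.
move=> x0 e0 xhalf; set u := vpos (x ** e - e).
suff u0 : u = 0.
  by have := vle_vpos (x ** e - e); rewrite -/u u0 vle_subl add0r.
apply/eqP; rewrite -normr_le0.
apply: (@le_of_le_harmonic _ _ `|e|) => m; rewrite addr0.
have [g [h [h0 eg xg hm]]] := neumann_partial_sum m x0 e0 xhalf.
have g0 := le_vle_trans e0 eg.
apply: (@le_trans _ _ `|h|).
  apply: (@le_of_le_harmonic _ _ `|g|) => n.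
  have ule : vle u (n.+1%:R^-1 *: g + h).
    rewrite vpos_le vaddr_ge0 ?vscale_ge0 ?invr_ge0// andbT vle_subl.
    by rewrite addrC addrA vmul_le_slices.
  rewrite (le_trans (ler_norm_pos (vpos_ge0 _) ule))//.
  rewrite (le_trans (ler_normD _ _))// lerD2r normrZ ger0_norm//.
apply: (le_trans hm); rewrite ler_wpM2r// exprVn lef_pV2 ?posrE ?exprn_gt0//.
by rewrite -natrX ler_nat ltn_expl.
Qed.

(** Multiplication by [x] lies in the centre of the vector lattice: it is
    dominated by a multiple of the identity. Hence every order ideal is
    invariant under multiplication from the left. *)
Lemma vmul_bounded (R : realType) (B : banachFAlgebraType R) (x : B) :
  exists c : R, 0 <= c /\ forall y, vle (vabs (x ** y)) (c *: vabs y).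
Proof.
have bounded_pos (p : B) : vle 0 p ->
    exists c : R, 0 <= c /\ forall y, vle (vabs (p ** y)) (c *: vabs y).
  move=> p0.
  (* Dividing [p] by [c] brings its norm below one half. *)
  pose c : R := 2 * (`|p| + 1).
  have c0 : 0 < c by rewrite mulr_gt0// ltr_wpDl.
  exists c; split=> [|y]; first exact: ltW.
  have pabs : vle (p ** vabs y) (c *: vabs y).
    have cn0 : c != 0 by rewrite gt_eqF.
    rewrite -[p ** _](scalerKV cn0) vleZ2// -vmulZl; apply: vmul_le_small.
    - by rewrite vscale_ge0// invr_ge0 ltW.
    - exact: vabs_ge0.
    - rewrite normrZ ger0_norm ?invr_ge0 ?(ltW c0)// mulrC ler_pdivrMr//.
      by rewrite /c mulKf// lerDl.
  rewrite vabs_le -vmulNr.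
  by rewrite !(le_vle_trans _ pabs)// le_vmull ?vle_abs ?vleN_abs.
have [c [c0 cP]] := bounded_pos _ (vpos_ge0 x).
have [d [d0 dP]] := bounded_pos _ (vpos_ge0 (- x)).
exists (c + d); split=> [|y]; first exact: addr_ge0.
rewrite -{1}(vposBN x) vmulDl vmulNl scalerDl.
apply: (le_vle_trans (vabsD _ _)); rewrite vleD//.
by rewrite -vmulNr (le_vle_trans (dP _))// vleZ// /vabs opprK vjoinC vle_refl.
Qed.

(** * Maximal order ideals *)

Record order_ideal (R : realType) (V : vectorLatticeType R) (N : set V) :
    Prop := {
  oi0 : N 0;
  oiD : forall x y, N x -> N y -> N (x + y);
  oiZ : forall (a : R) x, N x -> N (a *: x);
  oi_solid : forall x y, N y -> vle (vabs x) (vabs y) -> N x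
}.

Record maximal_avoiding (R : realType) (V : vectorLatticeType R) (e : V)
    (N : set V) : Prop := {
  ma_ideal : order_ideal N;
  ma_avoids : ~ N e;
  ma_max : forall M, order_ideal M -> N `<=` M -> ~ M e -> M `<=` N
}.

Section OrderIdeal.
Context {R : realType} {V : vectorLatticeType R}.
Implicit Types (x y z e : V) (a b c s t : R) (N M : set V).

Lemma oi_le N x y : order_ideal N -> N y -> vle (vabs x) y -> N x.
Proof.
move=> idN Ny xy; apply: (oi_solid idN Ny).
exact: le_vle_trans xy (vle_abs _).
Qed.

Lemma oi_le_pos N x y : order_ideal N -> N y -> vle 0 x -> vle x y -> N x.
Proof. by move=> idN Ny x0 xy; apply: (oi_le idN Ny); rewrite vabs_id. Qed.

Lemma oiN N x : order_ideal N -> N x -> N (- x).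
Proof. by move=> idN Nx; rewrite -scaleN1r; exact: oiZ. Qed.

Lemma oi_abs N x : order_ideal N -> N x -> N (vabs x).
Proof.
move=> idN Nx; apply: (oi_solid idN Nx).
by rewrite vabs_id ?vabs_ge0 ?vle_refl.
Qed.

Definition oi_adjoin N (u : V) : set V :=
  [set x | exists n s, [/\ N n, 0 <= s & vle (vabs x) (n + s *: u)]].

Lemma order_ideal_adjoin N u : order_ideal N -> order_ideal (oi_adjoin N u).
Proof.
move=> idN; split=> [|x y|a x|x y].
- exists 0, 0; split=> //; first exact: oi0.
  by rewrite scale0r addr0 vabs_id vle_refl.
- move=> [n [s [Nn s0 xn]]] [m [t [Nm t0 ym]]]; exists (n + m), (s + t).
  split; [exact: oiD|exact: addr_ge0|].
  by rewrite scalerDl addrACA (le_vle_trans (vabsD _ _))// vleD.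
- move=> [n [s [Nn s0 xn]]]; exists (`|a| *: n), (`|a| * s).
  split; [exact: oiZ|exact: mulr_ge0|].
  by rewrite -scalerA -scalerDr (le_vle_trans (vabsZ _ _))// vleZ.
- move=> [n [s [Nn s0 yn]]] xy; exists n, s; split=> //.
  exact: le_vle_trans xy yn.
Qed.

(** Zorn's lemma is applied to the sets that are empty or have the required
    properties: the empty chain then has an upper bound. *)
Lemma exists_maximal_avoiding (J : set V) e :
  order_ideal J -> ~ J e -> exists2 N, J `<=` N & maximal_avoiding e N.
Proof.
move=> idJ Je.
pose P (X : set V) := X !=set0 -> [/\ order_ideal X, ~ X e & J `<=` X].
have [|N [PN Nmax]] := @Zorn_bigcup _ P.
  move=> F FP Ftot [x [X FX Xx]].
  have good Y y : F Y -> Y y -> [/\ order_ideal Y, ~ Y e & J `<=` Y].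
    by move=> FY Yy; apply: (FP _ FY); exists y.
  have [idX _ JX] := good X x FX Xx.
  split; last by move=> y /JX Xy; exists X.
  - split.
    + by exists X => //; exact: oi0.
    + move=> y z [Y FY Yy] [Z FZ Zz].
      have [idY _ _] := good Y y FY Yy.
      have [idZ _ _] := good Z z FZ Zz.
      have [YZ|ZY] := Ftot _ _ FY FZ.
        by exists Z => //; apply: oiD => //; exact: YZ.
      by exists Y => //; apply: oiD => //; exact: ZY.
    + move=> a y [Y FY Yy]; have [idY _ _] := good Y y FY Yy.
      by exists Y => //; exact: oiZ.
    + move=> y z [Z FZ Zz] yz; have [idZ _ _] := good Z z FZ Zz.
      by exists Z => //; exact: (oi_solid idZ Zz).
  - by move=> [Y FY Ye]; have [_ + _] := good Y e FY Ye.
have N0 : N !=set0.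
  apply/set0P/eqP => N0; apply: (Nmax J) => [|_]; last by split.
  by rewrite N0; split=> [x []|/(_ 0 (oi0 idJ))].
have [idN Ne JN] := PN N0; exists N => //; split=> // M idM NM Me.
apply: contrapT => MN; apply: (Nmax M) => [|_]; first by split.
by split=> // x /JN/NM.
Qed.

Section MaximalAvoiding.
Context {e : V} {N : set V} (e0 : vle 0 e) (maxN : maximal_avoiding e N).
Let idN := ma_ideal maxN.

(** Maximality in the form in which it is used: modulo [N], every positive
    element outside [N] dominates [e] up to a scalar. *)
Lemma maximal_adjoin u : vle 0 u -> ~ N u ->
  exists n s, [/\ N n, 0 <= s & vle e (n + s *: u)].
Proof.
move=> u0 Nu; apply: contrapT => nadj; apply: Nu.
apply: (ma_max maxN (order_ideal_adjoin u idN)).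
- move=> x Nx; exists (vabs x), 0; split=> //; first exact: oi_abs.
  by rewrite scale0r addr0 vle_refl.
- move=> [n [s [Nn s0 en]]]; apply: nadj; exists n, s; split=> //.
  exact: le_vle_trans (vle_abs _) en.
- exists 0, 1; split=> //; first exact: oi0.
  by rewrite scale1r add0r vabs_id ?vle_refl.
Qed.

(** If neither [u] nor [v] is in [N] then [e] is dominated modulo [N] by a
    multiple of each of them, hence by a multiple of their meet [0]. *)
Lemma maximal_prime u v : vle 0 u -> vle 0 v -> vmeet u v = 0 -> N u \/ N v.
Proof.
move=> u0 v0 uv; apply: contrapT => /not_orP[Nu Nv].
have [n [s [Nn s0 en]]] := maximal_adjoin u0 Nu.
have [m [t [Nm t0 em]]] := maximal_adjoin v0 Nv.
pose k := vabs n + vabs m; pose r := s + t + 1.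
have r0 : 0 < r by rewrite ltr_wpDl// addr_ge0.
have k0 : vle 0 k by rewrite vaddr_ge0 ?vabs_ge0.
have Nk : N k by apply: oiD => //; exact: oi_abs.
apply: (ma_avoids maxN); apply: (oi_le_pos idN Nk e0).
have ru : vle (e - k) (r *: u).
  rewrite vle_subl addrC (le_vle_trans en)// vleD ?vleZr//; last first.
    by rewrite /r -addrA lerDl addr_ge0.
  exact: le_vle_trans (vle_abs _) (vle_addr _ (vabs_ge0 _)).
have rv : vle (e - k) (r *: v).
  rewrite vle_subl addrC (le_vle_trans em)// vleD ?vleZr//; last first.
    by rewrite /r addrAC lerDr addr_ge0.
  exact: le_vle_trans (vle_abs _) (vle_addl _ (vabs_ge0 _)).
have : vle (r^-1 *: (e - k)) (vmeet u v).
  by rewrite vle_meetr -(vleZ2 _ u r0) -(vleZ2 _ v r0) scalerKV ?gt_eqF// ru.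
by rewrite uv -(vleZ2 _ _ r0) scaler0 scalerKV ?gt_eqF// vle_subl add0r.
Qed.

(** The quotient by [N] has no infinitesimals: if [z] is not in [N] then [e] is
    dominated modulo [N] by some [s *: z], whereas an infinitesimal [z] satisfies
    [s *: z <= (s / (s + 1)) *: e] modulo [N]. *)
Lemma maximal_infinitesimal z : vle 0 z ->
  (forall eps : R, 0 < eps -> N (vpos (z - eps *: e))) -> N z.
Proof.
move=> z0 small; apply: contrapT => Nz.
have [n [s [Nn s0 en]]] := maximal_adjoin z0 Nz.
have s1 : 0 < s + 1 by rewrite ltr_wpDl.
have s1n : s + 1 != 0 by rewrite gt_eqF.
have := small (s + 1)^-1; rewrite invr_gt0 => /(_ s1).
set w := vpos _ => Nw; apply: (ma_avoids maxN).
have Nk : N ((s + 1) *: (n + s *: w)).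
  by apply: oiZ => //; apply: oiD => //; exact: oiZ.
apply: (oi_le_pos idN Nk e0).
(* Multiply the bound on [e] by [s + 1] and cancel [s *: e]. *)
have zw : vle ((s + 1) *: z) ((s + 1) *: w + e).
  rewrite -vle_subl -[X in _ - X](scalerKV s1n) -scalerBr vleZ2//.
  exact: vle_vpos.
have : vle ((s + 1) *: e) ((s + 1) *: (n + s *: w) + s *: e).
  apply: (le_vle_trans (vleZ (ltW s1) en)).
  rewrite !scalerDr -addrA vle_D2l !scalerA ![(s + 1) * s]mulrC -!scalerA.
  by rewrite -scalerDr vleZ.
by rewrite [s + 1]addrC {1}scalerDl scale1r vle_D2r.
Qed.

(** The quotient of the ideal generated by [e] by [N] is the real line. The
    coset of [y] is that of [t *: e], where [t] is the infimum of the reals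
    [s] with [y <= s *: e] modulo [N]; for [s < t] primality gives the reverse
    inequality. *)
Lemma maximal_quotient y c : vle (vabs y) (c *: e) -> exists t, N (y - t *: e).
Proof.
rewrite vabs_le => /andP[ylt ygt].
pose S := [set s | N (vpos (y - s *: e))].
have Sc : S c by rewrite /S /= vpos_le0 ?vle_subl ?add0r//; exact: oi0.
have lbS : lbound S (- c).
  move=> s Ss; rewrite leNgt; apply/negP => sc; apply: (ma_avoids maxN).
  have d0 : 0 < - c - s by rewrite subr_gt0.
  have Nd := oiZ idN (- c - s)^-1 Ss.
  apply: (oi_le_pos idN Nd e0).
  rewrite -(vleZ2 _ _ d0) scalerKV ?gt_eqF//.
  apply: le_vle_trans (vle_vpos _).
  by rewrite scalerBl vle_D2r scaleNr -vle_opp2 opprK.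
have hlS : has_lbound S by exists (- c).
have above s : inf S < s -> N (vpos (y - s *: e)).
  move=> /inf_lt-/(_ (ex_intro _ c Sc))[r Sr rs].
  apply: (oi_le_pos idN Sr); first exact: vpos_ge0.
  by rewrite le_vpos// vle_D2l vle_opp2 vleZr// ltW.
have below s : s < inf S -> N (vpos (s *: e - y)).
  move=> sS.
  have [Ns|] := maximal_prime (vpos_ge0 _) (vpos_ge0 _)
    (vpos_disjoint (y - s *: e)); last by rewrite opprB.
  by have := ge_inf hlS Ns; rewrite leNgt sS.
exists (inf S); apply: (oi_le idN _ (vle_refl _)).
apply: maximal_infinitesimal; first exact: vabs_ge0.
move=> eps eps0.
have Nu : N (vpos (y - (inf S + eps) *: e)) by apply: above; rewrite ltrDl.
have Nv : N (vpos ((inf S - eps) *: e - y)) by apply: below; rewrite gtrBl.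
apply: (oi_le_pos idN (oiD idN Nu Nv)); first exact: vpos_ge0.
rewrite vpos_le vaddr_ge0 ?vpos_ge0// andbT vle_subl vabs_le opprB.
rewrite -![vle _ (_ + _ + _)]vle_subl; apply/andP; split.
  apply: le_vle_trans (vle_addr _ (vpos_ge0 _)).
  by rewrite -addrA -opprD -scalerDl vle_vpos.
apply: le_vle_trans (vle_addl _ (vpos_ge0 _)).
by rewrite addrAC -scalerBl vle_vpos.
Qed.

Lemma maximal_scale0 t : N (t *: e) -> t = 0.
Proof.
move=> Nte; apply/eqP/negPn/negP => tn0; apply: (ma_avoids maxN).
by rewrite -(scalerK tn0 e); exact: oiZ.
Qed.

End MaximalAvoiding.
End OrderIdeal.

(** * Characters *)

Section Character.
Context {R : realType} {B : banachFAlgebraType R} {e : B} {N : set B}.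
Context (e0 : vle 0 e) (maxN : maximal_avoiding e N).
Let idN := ma_ideal maxN.

Lemma oi_mull x y : N y -> N (x ** y).
Proof.
move=> Ny; have [c [c0 xc]] := vmul_bounded x.
by apply: (oi_le idN _ (xc y)); apply: oiZ => //; exact: oi_abs.
Qed.

(** The character is read off from [x ** e = psi x *: e] modulo [N], where
    [x ** e] lies in the ideal generated by [e] because multiplication by [x]
    is bounded. It preserves products because [N] is invariant under
    multiplication, and positive parts because [N] is prime. *)
Lemma maximal_character : exists psi : B -> R,
  lattice_algebra_hom_on [set: B] psi /\
  forall x t, N (x ** e - t *: e) -> psi x = t.
Proof.
have /choice[psi psiP] : forall x, exists t, N (x ** e - t *: e).
  move=> x; have [c [c0 xc]] := vmul_bounded x.
  apply: (maximal_quotient e0 maxN (c := c)).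
  by rewrite -[X in c *: X]vabs_id.
have psi_uniq x t : N (x ** e - t *: e) -> psi x = t.
  move=> Nt; apply/esym/eqP; rewrite -subr_eq0; apply/eqP.
  apply: (maximal_scale0 maxN).
  have := oiD idN (psiP x) (oiN idN Nt).
  by rewrite opprB addrC addrA subrK scalerBl.
have psiD x y : psi (x + y) = psi x + psi y.
  apply: psi_uniq; rewrite vmulDl scalerDl opprD addrACA.
  exact: oiD.
have psiZ a x : psi (a *: x) = a * psi x.
  by apply: psi_uniq; rewrite vmulZl -scalerA -scalerBr; exact: oiZ.
have psiN x : psi (- x) = - psi x by rewrite -scaleN1r psiZ mulN1r.
have psi_ge0 x : vle 0 x -> 0 <= psi x.
  move=> x0; rewrite leNgt; apply/negP => x_lt0; apply: (ma_avoids maxN).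
  have Nx0 : 0 < - psi x by rewrite oppr_gt0.
  apply: (oi_le_pos idN (oiZ idN (- psi x)^-1 (psiP x)) e0).
  rewrite -(vleZ2 _ _ Nx0) scalerKV ?gt_eqF// scaleNr.
  by rewrite vle_addl// vmul_ge0.
have psi_pos x : psi (vpos x) = Num.max (psi x) 0.
  have ue0 y : vle 0 (vpos y ** e) by rewrite vmul_ge0 ?vpos_ge0.
  have disj : vmeet (vpos x ** e) (vpos (- x) ** e) = 0.
    have [+ _] := falg_disjoint _ _ e (vpos_disjoint x) e0.
    rewrite vmeetC => disj; rewrite vmeetC.
    by have [+ _] := falg_disjoint _ _ e disj e0.
  have psi0 y : N (vpos y ** e) -> psi (vpos y) = 0.
    by move=> Ny; apply: psi_uniq; rewrite scale0r subr0.
  have -> : psi x = psi (vpos x) - psi (vpos (- x)).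
    by rewrite -psiN -psiD vposBN.
  have [p0 q0] := (psi_ge0 _ (vpos_ge0 x), psi_ge0 _ (vpos_ge0 (- x))).
  have [/psi0 ->|/psi0 ->] := maximal_prime e0 maxN (ue0 _) (ue0 _) disj.
    by rewrite sub0r max_r// oppr_le0.
  by rewrite subr0 max_l.
have psi_join x y : psi (vjoin x y) = Num.max (psi x) (psi y).
  by rewrite vjoinE psiD psi_pos psiD psiN addr_maxl subrK add0r.
exists psi; split=> //; split=> // x y _ _.
- rewrite vmeetE !psiD psiN psi_join.
  by rewrite -(addr_max_min (psi x)) addrAC subrr add0r.
- apply: psi_uniq.
  have -> : x ** y ** e - (psi x * psi y) *: e =
      x ** (y ** e - psi y *: e) + psi y *: (x ** e - psi x *: e).
    rewrite vmulDr vmulNr vmulA vmulZr scalerBr scalerA [psi y * _]mulrC.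
    by rewrite addrA subrK.
  by apply: oiD => //; [exact: oi_mull|exact: oiZ].
Qed.

End Character.

Definition kernel_ideal (R : realType) (V : vectorLatticeType R) (A : set V)
    (phi : V -> R) : set V :=
  [set x | exists j, [/\ A j, phi j = 0 & vle (vabs x) j]].

Section Kernel.
Context {R : realType} {V : vectorLatticeAlgType R} {A : set V} {phi : V -> R}.
Context (subA : sublattice_algebra A) (hom_phi : lattice_algebra_hom_on A phi).

Lemma hom_sub x y : A x -> A y -> A (x - y) /\ phi (x - y) = phi x - phi y.
Proof.
move=> Ax Ay; have ANy : A (- y) by rewrite -scaleN1r; exact: slaZ.
split; first exact: slaD.
by rewrite (lahD hom_phi)// -[- y]scaleN1r (lahZ hom_phi)// mulN1r.
Qed.

Lemma hom_abs x : A x -> A (vabs x) /\ phi (vabs x) = `|phi x|.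
Proof.
move=> Ax; have ANx : A (- x) by rewrite -scaleN1r; exact: slaZ.
split; first exact: sla_join.
by rewrite (lah_join hom_phi)// -scaleN1r (lahZ hom_phi)// mulN1r maxrN.
Qed.

Lemma hom_le x y : A x -> A y -> vle x y -> phi x <= phi y.
Proof.
move=> Ax Ay xy.
have -> : y = vjoin x y.
  by apply: vle_anti; rewrite vle_joinR vle_joinl xy vle_refl.
by rewrite (lah_join hom_phi)// le_max lexx.
Qed.

Lemma order_ideal_kernel : order_ideal (kernel_ideal A phi).
Proof.
split=> [|x y|a x|x y].
- exists 0; split; [exact: sla0| |by rewrite vabs_id vle_refl].
  by rewrite -(scale0r 0) (lahZ hom_phi) ?mul0r//; exact: sla0.
- move=> [j [Aj j0 xj]] [k [Ak k0 yk]]; exists (j + k); split.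
  + exact: slaD.
  + by rewrite (lahD hom_phi)// j0 k0 addr0.
  + by apply: (le_vle_trans (vabsD _ _)); exact: vleD.
- move=> [j [Aj j0 xj]]; exists (`|a| *: j); split.
  + exact: slaZ.
  + by rewrite (lahZ hom_phi)// j0 mulr0.
  + by apply: (le_vle_trans (vabsZ _ _)); exact: vleZ.
- move=> [j [Aj j0 yj]] xy; exists j; split=> //.
  exact: le_vle_trans xy yj.
Qed.

(** Passing to the generated ideal adds no new elements of [A]. *)
Lemma kernel_ideal_hom x : A x -> kernel_ideal A phi x <-> phi x = 0.
Proof.
move=> Ax; have [Aax phi_ax] := hom_abs Ax; split.
- move=> [j [Aj j0 xj]]; apply/eqP; rewrite -normr_le0 -phi_ax -j0.
  exact: hom_le.
- by move=> x0; exists (vabs x); rewrite phi_ax x0 normr0 vle_refl.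
Qed.

End Kernel.

Theorem theorem3p15 (R : realType) (B : banachFAlgebraType R) (A : set B)
    (subA : sublattice_algebra A) (closedA : closed A)
    (phi : B -> R) (hom_phi : lattice_algebra_hom_on A phi) :
  exists psi : B -> R,
    lattice_algebra_hom_on [set: B] psi /\ forall x, A x -> psi x = phi x.
Proof.
have [[u Au phiu]|phi0] := pselect (exists2 u, A u & phi u != 0); last first.
  exists (fun=> 0); split.
    by split=> *; rewrite ?addr0 ?mulr0 ?maxxx ?minxx.
  move=> x Ax; apply/esym/eqP/negPn/negP => phix.
  by apply: phi0; exists x.
have [Aau phi_au] := hom_abs subA hom_phi Au.
pose e := `|phi u|^-1 *: vabs u.
have Ae : A e by exact: slaZ.
have e0 : vle 0 e by rewrite vscale_ge0 ?invr_ge0 ?vabs_ge0.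
have phie : phi e = 1 by rewrite (lahZ hom_phi)// phi_au mulVf// normr_eq0.
have kerE := kernel_ideal_hom subA hom_phi.
have [|N kerN maxN] := @exists_maximal_avoiding _ _ (kernel_ideal A phi) e
  (order_ideal_kernel subA hom_phi).
  by move=> /(kerE _ Ae)/eqP; rewrite phie oner_eq0.
have [psi [hom_psi psiE]] := maximal_character e0 maxN.
exists psi; split=> // x Ax; apply: psiE; apply: kerN.
have Axe : A (x ** e) by exact: slaM.
have Ate : A (phi x *: e) by exact: slaZ.
have [Asub phi_sub] := hom_sub subA hom_phi Axe Ate.
apply/(kerE _ Asub).
by rewrite phi_sub (lahM hom_phi)// (lahZ hom_phi _ Ae) subrr.
Qed.
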